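(* Let $n,d,u$ be integers with $d\ge 1$, $u\ge 0$ and $d+u\le n$. Consider repositories with $n$ packages, no conflicts ($C=\emptyset$), at most $d$ defects ($|D|\le d$) and at most $u$ unknown dependencies ($|U|\le u$). Any non-adaptive algorithm that solves Maximal Sub-repository on all such repositories must make at least $\mathcal S_{n,d-1,u+1}$ queries (in the worst case over its inputs).
   Context: A repository consists of a finite set $P$ of $n$ packages, a set $K\subseteq P\times P$ of known dependencies, a set $U\subseteq P\times P$ of unknown dependencies, a set $C$ of unknown conflicts (unordered pairs of distinct packages), and a set $D\subseteq P$ of defects. A dependency $(q,p)\in K\cup U$ means that $q$ depends on $p$. The digraph $(P,K)$ is acyclic. An installation is a subset $I\subseteq P$; it is successful iff (i) $I\cap D=\emptyset$, (ii) for every $(q,p)\in K\cup U$, $q\in I$ implies $p\in I$, and (iii) no $\{p,q\}\in C$ satisfies $p,q\in I$. A defect is a package contained in no successful installation, and $D$ is the set of all defects (so every package outside $D$ lies in some successful installation; in particular a package that depends on a defect is a defect). An algorithm is given $P$, $K$ and the bounds $d,u$. A query is an installation $I\subseteq P$; the oracle answers whether $I$ is successful. A non-adaptive algorithm fixes its whole set of queries from its input alone, then computes its output from the answers. Local computation is free; the cost is the number of queries. Maximal Sub-repository: find a maximum-size set of packages $P_{max}\subseteq P$ that is a successful installation. For $a,b\ge 0$ with $a+b\le n$, an $(n,a,b)$-cover-free family (CFF) is a set $\mathcal F\subseteq\{0,1\}^n$ such that for all disjoint $S_1,S_2\subseteq\{1,\dots,n\}$ with $|S_1|=a$, $|S_2|=b$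 there is $v\in\mathcal F$ with $v_i=0$ for all $i\in S_1$ and $v_i=1$ for all $i\in S_2$. $\mathcal S_{n,a,b}$ denotes the minimal size of an $(n,a,b)$-CFF. *)

(* Defs.v *)
From mathcomp Require Import all_boot.

Set Implicit Arguments.
Unset Strict Implicit.
Unset Printing Implicit Defensive.

(* A dependency (q, p) means that q depends on p. *)
Record repository (P : finType) := Repository {
  known : {set P * P};
  unknown : {set P * P};
  conflicts : {set {set P}};
  defects : {set P}
}.

(* [cycle] ranges over closed walks, so a self-loop (p, p) is a cycle. *)
Definition acyclic (P : finType) (K : {set P * P}) : Prop :=
  forall c : seq P, cycle (fun q p => (q, p) \in K) c -> c = [::].

Definition successful (P : finType) (r : repository P) (I : {set P}) : bool :=
  [&& I :&: defects r == set0,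
      [forall q : P, forall p : P,
         ((q, p) \in known r :|: unknown r) ==> (q \in I) ==> (p \in I)]
    & [forall p : P, forall q : P,
         ([set p; q] \in conflicts r) ==> ~~ ((p \in I) && (q \in I))]].

(* The last clause is a fixed-point condition: [successful r] itself refers to
   [defects r]. *)
Definition well_formed (P : finType) (r : repository P) : Prop :=
  [/\ acyclic (known r),
      {in conflicts r, forall c : {set P}, #|c| = 2}
    & defects r =
        [set p | [forall I : {set P}, successful r I ==> (p \notin I)]]].

Definition conflict_free_class (P : finType) (d u : nat) (r : repository P)
    : Prop :=
  [/\ well_formed r, conflicts r = set0, #|defects r| <= d
    & #|unknown r| <= u].

Definition maximum_installation (P : finType) (r : repository P) (M : {set P})
    : Prop :=
  successful r M /\ forall I : {set P}, successful r I -> #|I| <= #|M|.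

(* The inputs are the type P itself, the bounds d and u, and the set of known
   dependencies. The output is computed from these and from the set of pairs
   (query, answer). *)
Record nonadaptive_algorithm (P : finType) := NonadaptiveAlgorithm {
  queries : nat -> nat -> {set P * P} -> {set {set P}};
  output : nat -> nat -> {set P * P} -> {set {set P} * bool} -> {set P}
}.

Definition transcript (P : finType) (A : nonadaptive_algorithm P) (d u : nat)
    (r : repository P) : {set {set P} * bool} :=
  [set (I, successful r I) | I in queries A d u (known r)].

Definition solves_maximal_subrepository (P : finType)
    (A : nonadaptive_algorithm P) (d u : nat) : Prop :=
  forall r : repository P, conflict_free_class d u r ->
    maximum_installation r (output A d u (known r) (transcript A d u r)).

Definition is_cff (n a b : nat) (F : {set {ffun 'I_n -> bool}}) : bool :=
  [forall S1 : {set 'I_n}, forall S2 : {set 'I_n},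
     [&& [disjoint S1 & S2], #|S1| == a & #|S2| == b] ==>
     [exists v in F, [forall i in S1, v i == false] &&
                     [forall i in S2, v i == true]]].

(* The default value of the minimization, the full cube, is itself a CFF
   (lemma [is_cff_setT]), so this is a genuine minimum. *)
Definition min_cff_size (n a b : nat) : nat :=
  #|[arg min_(F < [set: {ffun 'I_n -> bool}] | is_cff a b F) #|F| ]|.

Lemma is_cff_setT (n a b : nat) : is_cff a b [set: {ffun 'I_n -> bool}].
Proof.
apply/forallP => S1; apply/forallP => S2; apply/implyP => /and3P[dS _ _].
apply/existsP; exists [ffun i => i \in S2]; rewrite inE /=.
apply/andP; split; apply/forall_inP => i iS; rewrite ffunE ?iS //.
by rewrite (disjointFr dS iS).
Qed.

Lemma min_cff_sizeP (n a b : nat) :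
  (exists2 F : {set {ffun 'I_n -> bool}},
     is_cff a b F & #|F| = min_cff_size n a b) /\
  (forall F : {set {ffun 'I_n -> bool}},
     is_cff a b F -> min_cff_size n a b <= #|F|).
Proof.
rewrite /min_cff_size; case: arg_minnP => [|F cF minF].
  exact: is_cff_setT.
by split; first by exists F.
Qed.

(* Main.v *)
Require Import Defs.
From mathcomp Require Import all_boot.

(** Take no known dependencies, disjoint [S1] and [S2] of sizes [d - 1] and
    [u + 1], and [p] in [S2].  Let [p] depend on the [u] other elements of
    [S2], and compare the defect sets [S1] and [p |: S1].  The maximum
    installations, [~: S1] and [~: (p |: S1)], differ, but only a query that
    avoids [S1] and contains [S2] is answered differently.  Hence such a query
    is always made, and the queries form a cover-free family. *)

Section Adversary.

Variable P : finType.
Implicit Types (U : {set P * P}) (D I S : {set P}) (p : P).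

Definition free_repository U D : repository P := Repository set0 U set0 D.

Lemma acyclic_set0 : acyclic (set0 : {set P * P}).
Proof.
case=> [//|x s]; rewrite /cycle.
by case: s => [|y s] /=; rewrite in_set0.
Qed.

Lemma successful_free U D I :
  successful (free_repository U D) I =
  [disjoint I & D] &&
  [forall q, forall p, ((q, p) \in U) ==> (q \in I) ==> (p \in I)].
Proof.
rewrite /successful /= set0U setI_eq0; congr andb.
rewrite -[RHS]andbT; congr andb.
by apply/forallP => x; apply/forallP => y; rewrite in_set0.
Qed.

(** The single installation [~: D] contains every package outside [D], which settles the fixed-point
    condition on defects. *)
Lemma free_repository_in_class d u U D :
  #|D| <= d -> #|U| <= u -> successful (free_repository U D) (~: D) ->
  conflict_free_class d u (free_repository U D).
Proof.
move=> leD leU sD; split=> //; split.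
- exact: acyclic_set0.
- by move=> c; rewrite in_set0.
apply/setP => x; rewrite inE; apply/idP/forallP => [xD I | noI].
  apply/implyP; rewrite successful_free => /andP[dI _].
  by rewrite (disjointFl dI xD).
by have := noI (~: D); rewrite sD inE negbK.
Qed.

(** Omitting the loop at [p] saves one edge, so a set of [u + 1] packages costs only [u] unknown
    dependencies. *)
Definition star p S : {set P * P} := [set (p, q) | q in S :\ p].

Lemma star_closed p S I :
  [forall q, forall q', ((q, q') \in star p S) ==> (q \in I) ==> (q' \in I)]
  = (p \in I) ==> (S \subset I).
Proof.
apply/'forall_forallP/implyP => [cI pI | cI x y].
  apply/subsetP => y yS; have [-> //|nyp] := eqVneq y p.
  have := cI p y; rewrite pI /= => /implyP; apply.
  by apply/imsetP; exists y; rewrite // !inE nyp.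
apply/implyP => /imsetP[z]; rewrite !inE => /andP[_ zS] [-> ->].
by apply/implyP => /cI /subsetP; apply.
Qed.

Lemma solver_queries_cover (A : nonadaptive_algorithm P) d u S1 S2 :
  0 < d -> solves_maximal_subrepository A d u -> [disjoint S1 & S2] ->
  #|S1| = d - 1 -> #|S2| = u + 1 ->
  exists2 I, I \in queries A d u set0 & [disjoint I & S1] && (S2 \subset I).
Proof.
move=> d_gt0 solA dS cS1 cS2; apply/exists_inP; apply: contraT => noI.
have /card_gt0P[p pS2] : 0 < #|S2| by rewrite cS2 addn1.
have pS1 : p \notin S1 by rewrite (disjointFl dS pS2).
pose r1 := free_repository (star p S2) S1.
pose r2 := free_repository (star p S2) (p |: S1).
have s1 : successful r1 (~: S1).
  rewrite successful_free star_closed -setI_eq0 setIC setICr eqxx /=.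
  by apply/implyP => _; rewrite -disjoints_subset disjoint_sym.
(* This installation misses [p], the only source of dependencies, so closure is vacuous. *)
have s2 : successful r2 (~: (p |: S1)).
  by rewrite successful_free star_closed -setI_eq0 setIC setICr !inE !eqxx.
have cU : #|star p S2| <= u.
  apply: leq_trans (leq_imset_card _ _) _.
  by have := cardsD1 p S2; rewrite cS2 pS2 addn1 => -[->].
have class1 : conflict_free_class d u r1.
  by apply: free_repository_in_class; rewrite ?cS1 ?leq_subr.
have class2 : conflict_free_class d u r2.
  by apply: free_repository_in_class; rewrite ?cardsU1 ?pS1 ?cS1 ?subnKC.
(* If [p] is not in [I], both answers say whether [I] avoids [S1]. If [p] is in [I], the answer for
   [r2] is negative, and the one for [r1] is too by [noI]. *)
have same_answers : transcript A d u r1 = transcript A d u r2.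
  apply: eq_in_imset => I qI; congr (_, _).
  rewrite !successful_free !star_closed.
  have /exists_inPn/(_ I qI) := noI.
  rewrite ![[disjoint I & _]]disjoint_sym !disjoints_subset subUset sub1set inE.
  by case: (p \in I); case: (S1 \subset _); case: (S2 \subset _).
have [_ max1] := solA r1 class1; have [suc2 _] := solA r2 class2.
(* The common output succeeds in [r2], so it avoids [p |: S1] and is smaller than [~: S1], which
   succeeds in [r1]. *)
have := max1 _ s1; rewrite same_answers leqNgt => /negP[].
apply: leq_ltn_trans (_ : #|~: (p |: S1)| < _).
  apply: subset_leq_card; rewrite -disjoints_subset.
  by move: suc2; rewrite successful_free => /andP[].
apply: proper_card; rewrite properC; apply/properP; split; first exact: subsetUr.
by exists p; rewrite // !inE eqxx.
Qed.

End Adversary.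

Theorem theorem4 (P : finType) (n d u : nat) (A : nonadaptive_algorithm P) :
  #|P| = n -> 1 <= d -> d + u <= n ->
  solves_maximal_subrepository A d u ->
  exists r : repository P,
    conflict_free_class d u r /\
    min_cff_size n (d - 1) (u + 1) <= #|queries A d u (known r)|.
Proof.
(* Queries depend only on the known dependencies, so any repository with none receives the
   adversary's query set. *)
move=> <- d_gt0 _ solA; exists (free_repository P set0 set0); split.
  apply: free_repository_in_class; rewrite ?cards0 // successful_free.
  rewrite -setI_eq0 setI0 eqxx /=.
  by apply/'forall_forallP => x y; rewrite in_set0.
(* Enumerating [P] turns queries into vectors; taking the image cannot increase their number. *)
pose indicator (I : {set P}) := [ffun i : 'I_#|P| => enum_val i \in I].
apply: leq_trans (leq_imset_card indicator _).
apply: (min_cff_sizeP _ _ _).2.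
apply/'forall_forallP => S1 S2; apply/implyP => /and3P[dS /eqP cS1 /eqP cS2].
have injE : injective (@enum_val P P) := @enum_val_inj _ _.
have dE : [disjoint enum_val @: S1 & enum_val @: S2].
  by rewrite imset_disjoint //; apply: in2W.
have [I qI /andP[dI sI]] := solver_queries_cover _ _ _ _ _ _ d_gt0 solA dE
  (etrans (card_imset _ injE) cS1) (etrans (card_imset _ injE) cS2).
apply/exists_inP; exists (indicator I); first exact: imset_f.
apply/andP; split; apply/forall_inP => i iS; rewrite ffunE.
  by rewrite (disjointFl dI) ?imset_f.
by rewrite (subsetP sI) ?imset_f.
Qed.
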